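(* Let $(X,d)$ be a cone metric space whose cone $P\subset E$ is normal with normal constant $k$, and let $r\in E$ with $0\ll r$. If $\{x_n\}$ and $\{y_n\}$ are two sequences in $X$ that are $\frac{1}{4k+2}r$-convergent to $x\in X$ and $y\in X$ respectively, then the sequence $\{z_n\}$ in $E$ defined by $z_n=d(x_n,y_n)$ for all $n\in\mathbb{N}$ is $\|r\|$-convergent to $d(x,y)$ in the normed linear space $E$.
   Context: Let $E$ be a real Banach space. A subset $P\subset E$ is a cone if (i) $P$ is closed, nonempty and $P\neq\{0\}$; (ii) $a,b\in\mathbb{R}$, $a,b\ge 0$, $x,y\in P$ implies $ax+by\in P$; (iii) $x\in P$ and $-x\in P$ implies $x=0$. Write $x\le y$ if $y-x\in P$, $x<y$ if $x\le y$ and $x\ne y$, and $x\ll y$ if $y-x\in \mathrm{int}\,P$ (the interior of $P$). The cone $P$ is normal with normal constant $k>0$ if for all $x,y\in E$, $0\le x\le y$ implies $\|x\|\le k\|y\|$. A cone metric space $(X,d)$ (associated with $E$ and $P$) is a nonempty set $X$ with a map $d:X\times X\to E$ such that for all $x,y,z\in X$: $0\le d(x,y)$, and $d(x,y)=0$ iff $x=y$; $d(x,y)=d(y,x)$; $d(x,y)\le d(x,z)+d(z,y)$. For $s\in E$ with $0\ll s$ or $s=0$, a sequence $\{x_n\}$ in $X$ is $s$-convergent to $x\in X$ if for every $\epsilon\in E$ with $0\ll\epsilon$ there is $m\in\mathbb{N}$ such that $d(x_n,x)\ll s+\epsilon$ for all $n\ge m$. For a nonnegative real number $\rho$, a sequence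 $\{z_n\}$ in a normed linear space $(E,\|\cdot\|)$ is $\rho$-convergent to $z$ if for every real $\epsilon>0$ there is $m\in\mathbb{N}$ such that $\|z_n-z\|<\rho+\epsilon$ for all $n\ge m$. *)

(* Defs.v *)
From HB Require Import structures.
From mathcomp Require Import all_boot all_order all_algebra.
From mathcomp Require Import all_classical all_reals all_analysis.

Set Implicit Arguments.
Unset Strict Implicit.
Unset Printing Implicit Defensive.

Import Order.TTheory GRing.Theory Num.Theory.
Import numFieldNormedType.Exports.

Local Open Scope classical_set_scope.
Local Open Scope ring_scope.

Record is_cone (R : realType) (E : completeNormedModType R) (P : set E) : Prop :=
  IsCone {
    cone_closed : closed P;
    cone_nonempty : P !=set0;
    cone_neq0 : P <> [set 0];
    cone_lincomb : forall (a b : R) (x y : E),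
      0 <= a -> 0 <= b -> P x -> P y -> P (a *: x + b *: y);
    cone_pointed : forall x : E, P x -> P (- x) -> x = 0 }.

Definition cone_le (R : realType) (E : completeNormedModType R) (P : set E)
  (x y : E) : Prop := P (y - x).

Definition cone_ll (R : realType) (E : completeNormedModType R) (P : set E)
  (x y : E) : Prop := (interior P) (y - x).

Definition normal_cone (R : realType) (E : completeNormedModType R)
    (P : set E) (k : R) : Prop :=
  0 < k /\
  forall x y : E, cone_le P 0 x -> cone_le P x y -> `|x| <= k * `|y|.

Record is_cone_metric (R : realType) (E : completeNormedModType R) (P : set E)
    (X : Type) (d : X -> X -> E) : Prop :=
  IsConeMetric {
    cone_metric_inhabited : inhabited X;
    cone_metric_ge0 : forall x y, cone_le P 0 (d x y);
    cone_metric_eq0 : forall x y, d x y = 0 <-> x = y;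
    cone_metric_sym : forall x y, d x y = d y x;
    cone_metric_triangle : forall x y z, cone_le P (d x y) (d x z + d z y) }.

(* Meaningful for [0 << s] or [s = 0]. *)
Definition cone_rough_cvg (R : realType) (E : completeNormedModType R)
    (P : set E) (X : Type) (d : X -> X -> E) (s : E) (u : nat -> X) (x : X)
    : Prop :=
  forall e : E, cone_ll P 0 e ->
    exists m : nat, forall n : nat, (m <= n)%N -> cone_ll P (d (u n) x) (s + e).

(* Meaningful for [0 <= rho]. *)
Definition rough_cvg (R : realType) (E : normedModType R) (rho : R)
    (u : nat -> E) (z : E) : Prop :=
  forall e : R, 0 < e ->
    exists m : nat, forall n : nat, (m <= n)%N -> `|u n - z| < rho + e.

(* Main.v *)
(* Put a = 1/(4k+2) + c with c > 0. Scaling r by c keeps it in the interior of P,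
   so eventually d(x_n, x) <= a r and d(y_n, y) <= a r, and two triangle
   inequalities give - 2 a r <= d(x_n, y_n) - d(x, y) <= 2 a r. Normality turns
   this into |d(x_n, y_n) - d(x, y)| <= (2k+1) |2 a r| = |r| + (4k+2) c |r|. *)

Require Import Defs.
From HB Require Import structures.
From mathcomp Require Import all_boot all_order all_algebra.
From mathcomp Require Import all_classical all_reals all_analysis.
From mathcomp Require Import ring lra.
Import Order.TTheory GRing.Theory Num.Theory.
Import numFieldNormedType.Exports.
Local Open Scope classical_set_scope.
Local Open Scope ring_scope.

Section Cone.
Context {R : realType} {E : completeNormedModType R} {P : set E}.
Hypothesis hP : is_cone P.

Lemma coneD (u v : E) : P u -> P v -> P (u + v).
Proof.
by move=> Pu Pv; rewrite -[u]scale1r -[v]scale1r; apply: cone_lincomb.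
Qed.

Lemma coneZ (c : R) (u : E) : 0 <= c -> P u -> P (c *: u).
Proof.
by move=> c0 Pu; rewrite -[_ *: _]addr0 -(scale0r u); apply: cone_lincomb.
Qed.

(** Scaling by [c^-1] is continuous and sends [c *: u] to [u], so it maps points near [c *: u] into
    [P]; scaling back by [c] stays in [P]. *)
Lemma cone_interiorZ (c : R) (u : E) :
  0 < c -> interior P u -> interior P (c *: u).
Proof.
move=> c0 Pu.
have cN0 : c != 0 by rewrite gt_eqF.
have cont : (fun v : E => c^-1 *: v) @ (c *: u) --> c^-1 *: (c *: u).
  exact: scaler_continuous.
rewrite scalerA mulVf // scale1r in cont.
have : \forall v \near c *: u, P (c^-1 *: v) by exact: cont.
by apply: filterS => v /(coneZ c _ (ltW c0)); rewrite scalerA divff // scale1r.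
Qed.

Lemma cone_le_trans (u v w : E) :
  cone_le P u v -> cone_le P v w -> cone_le P u w.
Proof. by move=> uv vw; move: (coneD _ _ vw uv); rewrite addrA subrK. Qed.

Lemma cone_leD (u v u' v' : E) :
  cone_le P u v -> cone_le P u' v' -> cone_le P (u + u') (v + v').
Proof. by move=> uv uv'; rewrite /cone_le opprD addrACA; apply: coneD. Qed.

Lemma cone_le_refl (u : E) : cone_le P u u.
Proof.
rewrite /cone_le subrr; have [v Pv] := cone_nonempty hP.
by rewrite -(scale0r v); apply: coneZ.
Qed.

(** Normality needs a lower bound 0, so - a <= w - z <= a is shifted to 0 <= w - z + a <= 2a. This
    costs 2k|a|, and removing the shift costs one more |a|. *)
Lemma normal_cone_norm_sub_le (k : R) (a w z : E) : normal_cone P k ->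
  cone_le P w (z + a) -> cone_le P z (w + a) ->
  `|w - z| <= (2 * k + 1) * `|a|.
Proof.
move=> [_ kP] wza zwa.
have le_wza : `|w - z + a| <= k * `|a + a|.
  apply: kP; rewrite /cone_le; first by rewrite subr0 addrAC.
  by rewrite opprD addrACA subrr addr0 opprB addrA [a + z]addrC.
have : `|w - z| <= `|w - z + a| + `|a|.
  by rewrite -{1}(addrK a (w - z)) ler_normB.
by move: le_wza; rewrite -mulr2n normrMn mulr2n; lra.
Qed.

Lemma cone_metric_triangle3 (X : Type) (d : X -> X -> E) (p x y q : X) :
  is_cone_metric P d -> cone_le P (d p q) (d p x + d x y + d y q).
Proof.
move=> hd; apply: cone_le_trans (cone_metric_triangle hd p q x) _.
rewrite -addrA; apply: cone_leD (cone_le_refl _) _.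
exact: cone_metric_triangle.
Qed.

End Cone.

Theorem theorem3p12 (R : realType) (E : completeNormedModType R) (P : set E)
    (X : Type) (d : X -> X -> E) (k : R) (r : E)
    (x_ y_ : nat -> X) (x y : X)
    (hP : is_cone P) (hk : normal_cone P k) (hd : is_cone_metric P d)
    (hr : cone_ll P 0 r)
    (hx : cone_rough_cvg P d ((1 / (4 * k + 2)) *: r) x_ x)
    (hy : cone_rough_cvg P d ((1 / (4 * k + 2)) *: r) y_ y) :
  rough_cvg `|r| (fun n : nat => d (x_ n) (y_ n)) (d x y).
Proof.
move=> e e0; have [k0 _] := hk.
have D0 : 0 < 4 * k + 2 by lra.
have r0 : 0 < `|r| + 1 by rewrite ltr_wpDl.
(* Chosen so that the excess (4k+2) c |r| equals e |r| / (|r| + 1); the [+ 1] keeps the denominator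
   positive and the final bound strictly below e. *)
pose c := e / ((4 * k + 2) * (`|r| + 1)).
have c0 : 0 < c by rewrite divr_gt0 ?mulr_gt0.
have cr0 : cone_ll P 0 (c *: r).
  rewrite /cone_ll subr0; apply: cone_interiorZ => //.
  by rewrite -[r]subr0.
have [[m1 xm1] [m2 ym2]] := (hx _ cr0, hy _ cr0).
exists (maxn m1 m2) => n; rewrite geq_max => /andP[/xm1 xn /ym2 yn].
move: xn yn; rewrite -scalerDl; set b := _ + c.
move=> /interior_subset xn /interior_subset yn.
(* Both outer legs of a three-leg path are replaced by [b *: r]; this serves the two directions
   below. *)
have bound u v p q w : cone_le P p (b *: r) -> cone_le P q (b *: r) ->
    cone_le P u (p + v + q) -> w = (2 * b) *: r -> cone_le P u (v + w).
  move=> pb qb uv ->; apply: (cone_le_trans hP) uv _.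
  rewrite mulr_natl -scalerMnl mulr2n addrA [v + _]addrC.
  by do 2!apply: cone_leD => //; exact: cone_le_refl.
have b0 : 0 <= b by rewrite addr_ge0 ?(ltW c0) ?divr_ge0 ?(ltW D0).
have : `|d (x_ n) (y_ n) - d x y| <= (2 * k + 1) * `|(2 * b) *: r|.
  (* The upper bound follows the path x_n, x, y, y_n; the lower bound follows x, x_n, y_n, y. *)
  apply: (normal_cone_norm_sub_le _ _ _ _ hk).
    apply: (bound _ _ _ _ _ _ _ (cone_metric_triangle3 hP _ d (x_ n) x y (y_ n) hd)) => //.
    by rewrite (cone_metric_sym hd).
  apply: (bound _ _ _ _ _ _ _ (cone_metric_triangle3 hP _ d x (x_ n) (y_ n) y hd)) => //.
  by rewrite (cone_metric_sym hd).
move=> /le_lt_trans; apply.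
rewrite normrZ ger0_norm ?mulr_ge0 //.
(* The factor 2(2k+1) = 4k+2 cancels the 1/(4k+2) in [b], leaving exactly |r|. *)
have -> : (2 * k + 1) * (2 * b * `|r|) = `|r| + e * (`|r| / (`|r| + 1)).
  by rewrite /b /c; field; rewrite !gt_eqF.
by rewrite ltrD2l gtr_pMr // ltr_pdivrMr // mul1r ltrDl.
Qed.
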